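(* Let $f:\mathbb{R}^n\to\mathbb{R}$ and let $\{x_k\}$ be the iterates generated by the Full-Low Evaluation algorithm (described in the context). Assume: (1) $f$ is continuously differentiable and $\nabla f$ is Lipschitz continuous with constant $L>0$; (2) there is $u_g>0$, independent of $k$, such that $\|\nabla f(x_k)-g_k\|\le u_g\,\beta_k\,\|g_k\|$ for every successful Full-Eval iteration $k$; (3) there are constants $\kappa,u_p>0$ such that, for every Full-Eval iteration $k$, $\frac{(-g_k)^\top p_k}{\|g_k\|\,\|p_k\|}>\kappa$ and $\|g_k\|\le u_p\|p_k\|$; (4) $f$ is bounded from below. If the set $\mathcal{I}_{SF}$ of successful Full-Eval iterations is infinite, then $$\lim_{k\in\mathcal{I}_{SF}}\nabla f(x_k)=0.$$
   Context: All norms are Euclidean. The Full-Low Evaluation algorithm minimizes $f:\mathbb{R}^n\to\mathbb{R}$ from an initial iterate $x_0$. Constants independent of $k$: $c\in(0,1)$, $\gamma>0$, $\bar\beta>0$, $\tau\in(0,1)$, $\lambda\ge 1$, $\theta\in(0,1)$, an initial direct-search stepsize $\alpha_0>0$, and a positive forcing function $\rho$. Each iteration $k=0,1,2,\ldots$ has a type $t_k\in\{\text{Full-Eval},\text{Low-Eval}\}$, with $t_0=$ Full-Eval. Full-Eval iteration (line search): compute an approximate gradient $g_k\in\mathbb{R}^n$ and a direction $p_k\in\mathbb{R}^n$. Try successively $\beta=\bar\beta,\tau\bar\beta,\tau^2\bar\beta,\ldots$ until either (a) $\beta<\gamma\rho(\alpha_k)$, in which case the iteration is unsuccessful, $x_{k+1}=x_k$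 and $t_{k+1}=$ Low-Eval; or (b) $\beta\ge\gamma\rho(\alpha_k)$ and $f(x_k+\beta p_k)\le f(x_k)+c\,\beta\,g_k^\top p_k$, in which case the iteration is successful, $\beta_k=\beta$, $x_{k+1}=x_k+\beta_kp_k$ and $t_{k+1}=$ Full-Eval. For each trial $\beta$, condition (a) is checked first. In both cases $\alpha_{k+1}=\alpha_k$. Low-Eval iteration (direct search): generate a finite set $D_k$ of non-zero directions. If $f(x_k+\alpha_kd_k)\le f(x_k)-\rho(\alpha_k)$ for some $d_k\in D_k$, the iteration is successful, $x_{k+1}=x_k+\alpha_kd_k$ and $\alpha_{k+1}=\lambda\alpha_k$; otherwise it is unsuccessful, $x_{k+1}=x_k$ and $\alpha_{k+1}=\theta\alpha_k$. In either case $t_{k+1}\in\{\text{Full-Eval},\text{Low-Eval}\}$ is chosen by an arbitrary rule. $\mathcal{I}_{SF}$ denotes the set of indices of successful Full-Eval iterations. *)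

(* Defs.v *)
From mathcomp Require Import all_boot all_order all_algebra.
From mathcomp Require Import all_classical all_reals all_analysis.

Set Implicit Arguments.
Unset Strict Implicit.
Unset Printing Implicit Defensive.

Import Order.TTheory GRing.Theory Num.Theory.
Import numFieldNormedType.Exports.

Local Open Scope classical_set_scope.
Local Open Scope ring_scope.

Definition dot (R : realType) (n : nat) (u v : 'rV[R]_n) : R :=
  \sum_(i < n) u 0 i * v 0 i.

(* The norm `|x| that MathComp-Analysis puts on 'rV[R]_n is the max norm, so
   the Euclidean norm is defined here. Differentiability and convergence do not
   depend on this choice. *)
Definition enorm (R : realType) (n : nat) (x : 'rV[R]_n) : R :=
  Num.sqrt (dot x x).

Definition gradient (R : realType) (n : nat) (f : 'rV[R]_n -> R)
    (x : 'rV[R]_n) : 'rV[R]_n :=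
  \row_(i < n) 'D_(delta_mx 0 i) f x.

Definition continuously_differentiable (R : realType) (n : nat)
    (f : 'rV[R]_n -> R) : Prop :=
  (forall x, differentiable f x) /\ continuous (gradient f).

Definition lipschitz_gradient (R : realType) (n : nat) (f : 'rV[R]_n -> R)
    (L : R) : Prop :=
  forall x y, enorm (gradient f x - gradient f y) <= L * enorm (x - y).

(* A positive forcing function is defined on the positive reals; values outside
   of that domain are irrelevant. Monotonicity and continuity, which some
   authors add, are not required. *)
Definition positive_forcing (R : realType) (rho : R -> R) : Prop :=
  (forall a, 0 < a -> 0 < rho a) /\ rho a / a @[a --> 0^'+] --> 0.

Record full_low_constants (R : realType) := FullLowConstants {
  armijo_c : R;        (* c *)
  gamma : R;
  beta_bar : R;
  tau : R;
  lambda : R;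
  theta : R;
  alpha_init : R;      (* alpha_0 *)
  rho : R -> R;
  armijo_c_bounds : 0 < armijo_c < 1;
  gamma_gt0 : 0 < gamma;
  beta_bar_gt0 : 0 < beta_bar;
  tau_bounds : 0 < tau < 1;
  lambda_ge1 : 1 <= lambda;
  theta_bounds : 0 < theta < 1;
  alpha_init_gt0 : 0 < alpha_init;
  rho_forcing : positive_forcing rho
}.

Inductive iteration_type := FullEval | LowEval.

(* The component [beta] is meaningful only at successful Full-Eval iterations,
   [gk] and [pk] only at Full-Eval iterations, [Dk] only at Low-Eval iterations. *)
Record history (R : realType) (n : nat) := History {
  iterate : nat -> 'rV[R]_n;       (* x_k *)
  alpha : nat -> R;
  itype : nat -> iteration_type;    (* t_k *)
  success : nat -> bool;
  gk : nat -> 'rV[R]_n;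
  pk : nat -> 'rV[R]_n;
  beta : nat -> R;
  Dk : nat -> seq 'rV[R]_n
}.

Section Algorithm.
Context (R : realType) (n : nat) (f : 'rV[R]_n -> R).
Context (P : full_low_constants R).

Definition trial (j : nat) : R := beta_bar P * tau P ^+ j.

Definition too_small (a b : R) : Prop := b < gamma P * rho P a.

Definition sufficient_decrease (x g p : 'rV[R]_n) (b : R) : Prop :=
  f (x + b *: p) <= f x + armijo_c P * b * dot g p.

Definition reaches_trial (x g p : 'rV[R]_n) (a : R) (j : nat) : Prop :=
  forall i, (i < j)%N ->
    ~ too_small a (trial i) /\ ~ sufficient_decrease x g p (trial i).

Definition line_search_fails (x g p : 'rV[R]_n) (a : R) : Prop :=
  exists j, reaches_trial x g p a j /\ too_small a (trial j).

Definition line_search_accepts (x g p : 'rV[R]_n) (a b : R) : Prop :=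
  exists j, [/\ reaches_trial x g p a j, b = trial j,
    ~ too_small a b & sufficient_decrease x g p b].

Definition direct_search_decrease (x : 'rV[R]_n) (a : R) (d : 'rV[R]_n) : Prop :=
  f (x + a *: d) <= f x - rho P a.

Definition full_eval_step (h : history R n) (k : nat) : Prop :=
  alpha h k.+1 = alpha h k /\
  if success h k then
    [/\ line_search_accepts (iterate h k) (gk h k) (pk h k) (alpha h k) (beta h k),
        iterate h k.+1 = iterate h k + beta h k *: pk h k &
        itype h k.+1 = FullEval]
  else
    [/\ line_search_fails (iterate h k) (gk h k) (pk h k) (alpha h k),
        iterate h k.+1 = iterate h k &
        itype h k.+1 = LowEval].

(* The type of iteration k + 1 is left unconstrained. *)
Definition low_eval_step (h : history R n) (k : nat) : Prop :=
  (forall d, d \in Dk h k -> d != 0) /\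
  if success h k then
    (exists2 d, d \in Dk h k &
       direct_search_decrease (iterate h k) (alpha h k) d /\
       iterate h k.+1 = iterate h k + alpha h k *: d) /\
    alpha h k.+1 = lambda P * alpha h k
  else
    [/\ forall d, d \in Dk h k ->
          ~ direct_search_decrease (iterate h k) (alpha h k) d,
        iterate h k.+1 = iterate h k &
        alpha h k.+1 = theta P * alpha h k].

Definition generated_by_full_low (x0 : 'rV[R]_n) (h : history R n) : Prop :=
  [/\ iterate h 0%N = x0, alpha h 0%N = alpha_init P, itype h 0%N = FullEval &
      forall k, match itype h k with
                | FullEval => full_eval_step h k
                | LowEval => low_eval_step h k
                end].

End Algorithm.

Definition successful_full_eval (R : realType) (n : nat) (h : history R n) :
    set nat :=
  [set k | itype h k = FullEval /\ success h k].

(* Main.v *)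
Require Import Defs.
From mathcomp Require Import all_boot all_order all_algebra.
From mathcomp Require Import all_classical all_reals all_analysis.
From mathcomp Require Import ring lra.
Set Implicit Arguments.
Unset Strict Implicit.
Unset Printing Implicit Defensive.
Import Order.TTheory GRing.Theory Num.Theory.
Import numFieldNormedType.Exports.
Local Open Scope classical_set_scope.
Local Open Scope ring_scope.

(** Write [x], [g], [p], [b] for the data of a successful Full-Eval iteration.
    The angle condition turns the Armijo inequality into a decrease of [f] of at
    least [c kappa b |g| |p|], so the point is to bound [b |p|] below by a
    multiple of [|g|]. If the first trial [beta_bar] is accepted, this is the
    hypothesis [|g| <= u_p |p|]. Otherwise the trial [b / tau] failed the Armijo
    test; comparing the failure with a first-order expansion of [f], whose
    remainder is controlled by the Lipschitz constant, and with the error of [g],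
    which is itself at most [u_g b |g|], gives the bound
    ([accepted_step_length]).

    Each successful Full-Eval iteration thus decreases [f] by at least a multiple
    of [|g|^2], hence of [|gradient f x|^2], because the error
    of [g] is at most [u_g beta_bar |g|] ([successful_full_eval_decrease]). No
    other iteration increases [f] ([full_low_nonincreasing]). As [f] is bounded below, the values of [f] along
    the iterates converge, their successive differences tend to 0, and so does
    the gradient along the successful Full-Eval iterations. *)

(** * Euclidean inner product and norm *)

Lemma dotC (R : realType) (n : nat) (u v : 'rV[R]_n) : dot u v = dot v u.
Proof. by apply: eq_bigr => i _; rewrite mulrC. Qed.

Lemma dotDl (R : realType) (n : nat) (u v w : 'rV[R]_n) :
  dot (u + v) w = dot u w + dot v w.
Proof. by rewrite -big_split; apply: eq_bigr => i _; rewrite !mxE mulrDl. Qed.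

Lemma dotZl (R : realType) (n : nat) (a : R) (u v : 'rV[R]_n) :
  dot (a *: u) v = a * dot u v.
Proof. by rewrite mulr_sumr; apply: eq_bigr => i _; rewrite !mxE mulrA. Qed.

Lemma dotNl (R : realType) (n : nat) (u v : 'rV[R]_n) : dot (- u) v = - dot u v.
Proof. by rewrite -scaleN1r dotZl mulN1r. Qed.

Lemma dotDr (R : realType) (n : nat) (u v w : 'rV[R]_n) :
  dot u (v + w) = dot u v + dot u w.
Proof. by rewrite dotC dotDl !(dotC u). Qed.

Lemma dotZr (R : realType) (n : nat) (a : R) (u v : 'rV[R]_n) :
  dot u (a *: v) = a * dot u v.
Proof. by rewrite dotC dotZl dotC. Qed.

Lemma dotNr (R : realType) (n : nat) (u v : 'rV[R]_n) : dot u (- v) = - dot u v.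
Proof. by rewrite dotC dotNl dotC. Qed.

Lemma dot_ge0 (R : realType) (n : nat) (u : 'rV[R]_n) : 0 <= dot u u.
Proof. by apply: sumr_ge0 => i _; rewrite -expr2 sqr_ge0. Qed.

Lemma enorm_ge0 (R : realType) (n : nat) (u : 'rV[R]_n) : 0 <= enorm u.
Proof. exact: sqrtr_ge0. Qed.

Lemma sqr_enorm (R : realType) (n : nat) (u : 'rV[R]_n) :
  enorm u ^+ 2 = dot u u.
Proof. by rewrite sqr_sqrtr // dot_ge0. Qed.

Lemma enorm_eq0 (R : realType) (n : nat) (u : 'rV[R]_n) :
  enorm u = 0 -> u = 0.
Proof.
move=> u0; have /eqP : dot u u = 0 by rewrite -sqr_enorm u0 expr0n.
rewrite psumr_eq0 => [/allP uu0|i _]; last by rewrite -expr2 sqr_ge0.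
apply/rowP => i; have := uu0 i (mem_index_enum i).
by rewrite /= -expr2 sqrf_eq0 mxE => /eqP.
Qed.

Lemma enormZ (R : realType) (n : nat) (a : R) (u : 'rV[R]_n) :
  enorm (a *: u) = `|a| * enorm u.
Proof.
by rewrite /enorm dotZl dotZr mulrA -expr2 sqrtrM ?sqr_ge0 // sqrtr_sqr.
Qed.

(** Expand the nonnegative square of |v| u - |u| v. *)
Lemma dot_le_enorm (R : realType) (n : nat) (u v : 'rV[R]_n) :
  dot u v <= enorm u * enorm v.
Proof.
have [/eqP/enorm_eq0->|u0] := boolP (enorm u == 0).
  by rewrite -(scale0r 0) dotZl mul0r mulr_ge0 ?enorm_ge0.
have [/eqP/enorm_eq0->|v0] := boolP (enorm v == 0).
  by rewrite -(scale0r 0) dotZr mul0r mulr_ge0 ?enorm_ge0.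
have uv0 : 0 < enorm u * enorm v by rewrite mulr_gt0 // lt0r ?u0 ?v0 enorm_ge0.
have := dot_ge0 (enorm v *: u - enorm u *: v).
rewrite !(dotDl, dotDr, dotNl, dotNr, dotZl, dotZr) (dotC v u) -!sqr_enorm.
set a := enorm u in uv0 *; set b := enorm v in uv0 *; set d := dot u v => H.
have : 0 <= 2 * (a * b) * (a * b - d) by lra.
by rewrite pmulr_rge0 ?subr_ge0 // mulr_gt0.
Qed.

Lemma enormD (R : realType) (n : nat) (u v : 'rV[R]_n) :
  enorm (u + v) <= enorm u + enorm v.
Proof.
rewrite -ler_sqr ?nnegrE ?addr_ge0 ?enorm_ge0 //.
rewrite sqrrD !sqr_enorm dotDl !dotDr (dotC v u).
have := dot_le_enorm u v; lra.
Qed.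

(** Brings Euclidean estimates back to the norm that defines convergence of row
    vectors. *)
Lemma mx_norm_le_enorm (R : realType) (n : nat) (u : 'rV[R]_n) :
  `|u| <= enorm u.
Proof.
rewrite {1}/Num.norm /=.
have [->|/mx_norm_neq0[[i j] ->]] := eqVneq (mx_norm u) 0; first exact: enorm_ge0.
rewrite /= (ord1 i) -sqrtr_sqr ler_wsqrtr // /dot (bigD1 j) //= expr2 lerDl.
by apply: sumr_ge0 => k _; rewrite -expr2 sqr_ge0.
Qed.

(** * First-order expansion with a Lipschitz gradient *)

Lemma derive_gradient (R : realType) (n : nat) (f : 'rV[R]_n -> R)
    (x v : 'rV[R]_n) :
  differentiable f x -> 'D_v f x = dot (gradient f x) v.
Proof.
move=> df; rewrite deriveE // {1}(row_sum_delta v) linear_sum.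
by apply: eq_bigr => i _; rewrite linearZ /= mxE deriveE // mulrC.
Qed.

Lemma is_derive_line (R : realType) (n : nat) (f : 'rV[R]_n -> R)
    (x v : 'rV[R]_n) (t : R) :
  differentiable f (x + t *: v) ->
  is_derive t 1 (fun s : R => f (x + s *: v))
    (dot (gradient f (x + t *: v)) v).
Proof.
move=> df; rewrite -derive_gradient //.
(* The two difference quotients are the same function of the increment. *)
have E : (fun h : R => h^-1 *: (((fun s : R => f (x + s *: v)) \o shift t) (h *: 1)
            - f (x + t *: v)))
       = (fun h : R => h^-1 *: ((f \o shift (x + t *: v)) (h *: v)
            - f (x + t *: v))).
  apply/funext => h /=; congr (_ *: (f _ - _)).
  by rewrite scalerDl [h *: 1]mulr1 addrCA.
split; last by rewrite /derive E.
by rewrite /derivable E; exact: diff_derivable.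
Qed.

(** The mean value theorem evaluates the gradient somewhere on the segment, and
    its Lipschitz continuity brings it back to [x]. An integral instead of the
    mean value theorem would give the sharper constant [L / 2]; any constant
    serves here. *)
Lemma descent (R : realType) (n : nat) (f : 'rV[R]_n -> R) (L : R)
    (x v : 'rV[R]_n) :
  (forall y, differentiable f y) -> 0 < L -> lipschitz_gradient f L ->
  f (x + v) <= f x + dot (gradient f x) v + L * enorm v ^+ 2.
Proof.
move=> df L0 lip.
have dphi (t : R) := is_derive_line (df (x + t *: v)).
have [|t /itvP t01] := MVT (@ltr01 R) (fun t _ => dphi t).
  by apply: derivable_within_continuous => t _; case: (dphi t).
rewrite scale1r scale0r addr0 subr0 mulr1 => fE.
have -> : f (x + v) = f x + dot (gradient f x) v
    + dot (gradient f (x + t *: v) - gradient f x) v.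
  by rewrite dotDl dotNl -fE; ring.
rewrite lerD2l (le_trans (dot_le_enorm _ _)) // expr2 mulrA.
rewrite ler_wpM2r ?enorm_ge0 // (le_trans (lip _ _)) // ler_pM2l //.
rewrite (addrC x) addrK enormZ ger0_norm ?t01 //.
by rewrite ler_piMl ?enorm_ge0 ?t01.
Qed.

(** * Length of an accepted line-search step *)

(** The Armijo test allows the fraction [1 - c] of the decrease predicted by [g],
    which the angle condition makes proportional to [b |g| |p|], to be lost. At
    the rejected trial [b / tau] the gradient error and the curvature, which are
    of second order in [b], have exceeded that margin. Since
    only [|g| <= u_p |p|] is known, and not the reverse, this bounds the length
    [b |p|] of the step from below and not [b] itself. *)
Lemma step_length_after_rejection (R : realType) (n : nat) (f : 'rV[R]_n -> R)
    (P : full_low_constants R) (L u_g kappa u_p b : R) (x g p : 'rV[R]_n) :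
  (forall y, differentiable f y) -> 0 < L -> lipschitz_gradient f L ->
  0 < u_g -> 0 < b -> 0 < enorm g -> 0 < enorm p ->
  enorm (gradient f x - g) <= u_g * b * enorm g ->
  kappa * (enorm g * enorm p) < dot (- g) p ->
  enorm g <= u_p * enorm p ->
  ~ sufficient_decrease f P x g p (b / tau P) ->
  (1 - armijo_c P) * kappa * enorm g
    <= (u_g * u_p + L / tau P) * (b * enorm p).
Proof.
move=> df L0 lip ug0 b0 g0 p0 gerr angle gp /negP.
have /andP[tau0 _] := tau_bounds P; have /andP[_ c1] := armijo_c_bounds P.
rewrite -ltNge; set b' := b / tau P => rejected.
have b'0 : 0 < b' by rewrite divr_gt0.
have := descent x (b' *: p) df L0 lip.
rewrite dotZr enormZ (ger0_norm (ltW b'0)) => taylor.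
have Herr : dot (gradient f x) p <= dot g p + u_g * b * enorm g * enorm p.
  have -> : dot (gradient f x) p = dot g p + dot (gradient f x - g) p.
    by rewrite dotDl dotNl; ring.
  by rewrite lerD2l (le_trans (dot_le_enorm _ _)) // ler_wpM2r // ltW.
rewrite dotNl in angle.
have model : armijo_c P * dot g p
    < dot (gradient f x) p + L * b' * enorm p ^+ 2.
  by rewrite -(ltr_pM2l b'0); lra.
have second_order : (1 - armijo_c P) * kappa * enorm g * enorm p
    <= (u_g * b * enorm g + L * b' * enorm p) * enorm p.
  have : (1 - armijo_c P) * (kappa * (enorm g * enorm p))
      < (1 - armijo_c P) * - dot g p by rewrite ltr_pM2l ?subr_gt0.
  by lra.
move: second_order; rewrite ler_pM2r // => /le_trans; apply.
have : u_g * b * enorm g <= u_g * b * (u_p * enorm p).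
  by rewrite ler_pM2l ?mulr_gt0.
rewrite /b'; set t := (tau P)^-1; lra.
Qed.

Lemma trial_bounds (R : realType) (P : full_low_constants R) (j : nat) :
  0 < trial P j <= beta_bar P.
Proof.
have /andP[tau0 tau1] := tau_bounds P; have b0 := beta_bar_gt0 P.
by rewrite /trial mulr_gt0 ?exprn_gt0 // ler_piMr ?exprn_ile1 // ltW.
Qed.

(** The first term of the minimum covers acceptance of the initial trial
    [beta_bar], the second acceptance after at least one rejection. *)
Definition step_ratio (R : realType) (P : full_low_constants R)
    (L u_g kappa u_p : R) : R :=
  Num.min (beta_bar P / u_p)
    ((1 - armijo_c P) * kappa / (u_g * u_p + L / tau P)).

Lemma step_ratio_gt0 (R : realType) (P : full_low_constants R)
    (L u_g kappa u_p : R) :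
  0 < L -> 0 < u_g -> 0 < kappa -> 0 < u_p -> 0 < step_ratio P L u_g kappa u_p.
Proof.
move=> L0 ug0 k0 up0; have /andP[tau0 _] := tau_bounds P.
have /andP[_ c1] := armijo_c_bounds P.
rewrite lt_min !divr_gt0 ?beta_bar_gt0 ?mulr_gt0 ?subr_gt0 //.
by rewrite addr_gt0 ?divr_gt0 ?mulr_gt0.
Qed.

Lemma accepted_step_length (R : realType) (n : nat) (f : 'rV[R]_n -> R)
    (P : full_low_constants R) (L u_g kappa u_p a b : R) (x g p : 'rV[R]_n) :
  (forall y, differentiable f y) -> 0 < L -> lipschitz_gradient f L ->
  0 < u_g -> 0 < u_p -> 0 < enorm g -> 0 < enorm p ->
  enorm (gradient f x - g) <= u_g * b * enorm g ->
  kappa * (enorm g * enorm p) < dot (- g) p ->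
  enorm g <= u_p * enorm p ->
  line_search_accepts f P x g p a b ->
  step_ratio P L u_g kappa u_p * enorm g <= b * enorm p.
Proof.
move=> df L0 lip ug0 up0 g0 p0 gerr angle gp [j [reach bE _ _]].
have /andP[b0 _] := trial_bounds P j; rewrite -bE in b0.
have /andP[tau0 _] := tau_bounds P.
case: j => [|j] in reach bE *.
  apply: (@le_trans _ _ (beta_bar P / u_p * enorm g)).
    by rewrite ler_pM2r // ge_min lexx.
  rewrite bE /trial expr0 mulr1 -mulrA ler_pM2l ?beta_bar_gt0 //.
  by rewrite mulrC ler_pdivrMr // mulrC.
have [_ rejected] := reach j (ltnSn j).
have E : b / tau P = trial P j.
  by rewrite bE /trial exprSr mulrA mulfK // gt_eqF.
rewrite -E in rejected.
have len := step_length_after_rejection df L0 lip ug0 b0 g0 p0 gerr angle gp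
  rejected.
apply: (@le_trans _ _
    ((1 - armijo_c P) * kappa / (u_g * u_p + L / tau P) * enorm g)).
  by rewrite ler_pM2r // ge_min lexx orbT.
rewrite mulrAC ler_pdivrMr; first by rewrite mulrC [b * _ * _]mulrC [enorm g * _]mulrC.
by rewrite addr_gt0 ?divr_gt0 ?mulr_gt0.
Qed.

(** * Decrease of the objective along a run *)

Lemma alpha_gt0 (R : realType) (n : nat) (f : 'rV[R]_n -> R)
    (P : full_low_constants R) (x0 : 'rV[R]_n) (h : history R n) (k : nat) :
  generated_by_full_low f P x0 h -> 0 < alpha h k.
Proof.
case=> _ a0 _ step; elim: k => [|k IH]; first by rewrite a0 alpha_init_gt0.
have := step k; case: (itype h k) => [[-> _] //|[_]].
case: (success h k) => [[_ ->]|[_ _ ->]].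
  by rewrite mulr_gt0 // (lt_le_trans ltr01) // lambda_ge1.
by rewrite mulr_gt0 //; have /andP[] := theta_bounds P.
Qed.

(** The numerator compares [|gradient f x|] with [|g|]; the denominator is the
    decrease of [f] guaranteed per unit of [|g|^2]. *)
Definition squared_gradient_factor (R : realType) (P : full_low_constants R)
    (L u_g kappa u_p : R) : R :=
  (1 + u_g * beta_bar P) ^+ 2
    / (armijo_c P * kappa * step_ratio P L u_g kappa u_p).

(** Division by zero yields 0, so a strictly positive lower bound on the cosine
    forces both vectors to be nonzero. *)
Lemma angle_condition_nonzero (R : realType) (n : nat) (kappa : R)
    (g p : 'rV[R]_n) :
  0 < kappa -> kappa < dot (- g) p / (enorm g * enorm p) ->
  [/\ 0 < enorm g, 0 < enorm p & kappa * (enorm g * enorm p) < dot (- g) p].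
Proof.
move=> k0 angle.
have gp0 : enorm g * enorm p != 0.
  apply: contraTN angle => /eqP->; by rewrite invr0 mulr0 -leNgt ltW.
have [g0 p0] : 0 < enorm g /\ 0 < enorm p.
  by move: gp0; rewrite mulf_eq0 negb_or !lt0r !enorm_ge0 => /andP[-> ->].
by split=> //; rewrite -ltr_pdivlMr // mulr_gt0.
Qed.

(** The decrease [c kappa b |g| |p|] becomes [c kappa r |g|^2] by the lower bound
    [r |g|] on the step length, and [|g|] bounds the true gradient up to a
    factor because [b <= beta_bar]. *)
Lemma successful_full_eval_decrease (R : realType) (n : nat)
    (f : 'rV[R]_n -> R) (P : full_low_constants R) (x0 : 'rV[R]_n)
    (h : history R n) (L u_g kappa u_p : R) (k : nat) :
  generated_by_full_low f P x0 h ->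
  (forall y, differentiable f y) -> 0 < L -> lipschitz_gradient f L ->
  0 < u_g -> 0 < kappa -> 0 < u_p ->
  enorm (gradient f (iterate h k) - gk h k)
    <= u_g * beta h k * enorm (gk h k) ->
  kappa < dot (- gk h k) (pk h k) / (enorm (gk h k) * enorm (pk h k)) ->
  enorm (gk h k) <= u_p * enorm (pk h k) ->
  successful_full_eval h k ->
  enorm (gradient f (iterate h k)) ^+ 2
    <= squared_gradient_factor P L u_g kappa u_p
       * (f (iterate h k) - f (iterate h k.+1)).
Proof.
move=> [_ _ _ step] df L0 lip ug0 k0 up0 gerr angle gp [tk sk].
have := step k; rewrite tk /full_eval_step sk => -[_ [accepts -> _]].
have [g0 p0 {}angle] := angle_condition_nonzero k0 angle.
have len := accepted_step_length df L0 lip ug0 up0 g0 p0 gerr angle gp accepts.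
case: accepts => j [_ bE _]; rewrite /sufficient_decrease.
have /andP[b0 b1] := trial_bounds P j; rewrite -bE in b0 b1.
have /andP[c0 _] := armijo_c_bounds P.
have r0 := step_ratio_gt0 P L0 ug0 k0 up0.
set x := iterate h k in gerr *; set g := gk h k in gerr angle gp g0 len *.
set p := pk h k in angle gp p0 len *; set b := beta h k in gerr b0 b1 len *.
set r := step_ratio _ _ _ _ _ in r0 len *.
move=> armijo; set df_k := f x - f (x + b *: p).
have gradle : enorm (gradient f x) <= (1 + u_g * beta_bar P) * enorm g.
  have := enormD (gradient f x - g) g; rewrite subrK => /le_trans; apply.
  have : u_g * b * enorm g <= u_g * beta_bar P * enorm g.
    by rewrite ler_pM2r // ler_pM2l.
  by lra.
have decrease : armijo_c P * kappa * r * enorm g ^+ 2 <= df_k.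
  have : armijo_c P * kappa * enorm g * (r * enorm g)
      <= armijo_c P * kappa * enorm g * (b * enorm p).
    by rewrite ler_pM2l // !mulr_gt0.
  have : armijo_c P * b * (kappa * (enorm g * enorm p))
      < armijo_c P * b * dot (- g) p by rewrite ltr_pM2l // mulr_gt0.
  rewrite dotNl /df_k expr2; lra.
have d0 : 0 < armijo_c P * kappa * r by rewrite !mulr_gt0.
have B0 : 0 <= 1 + u_g * beta_bar P.
  by rewrite addr_ge0 // mulr_ge0 // ltW // beta_bar_gt0.
apply: (@le_trans _ _ (((1 + u_g * beta_bar P) * enorm g) ^+ 2)).
  by rewrite ler_sqr ?nnegrE ?enorm_ge0 // mulr_ge0 // enorm_ge0.
rewrite exprMn /squared_gradient_factor -mulrA ler_wpM2l ?sqr_ge0 //.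
by rewrite mulrC ler_pdivlMr // mulrC.
Qed.

(** Full-Eval steps decrease [f] by the Armijo condition and the angle condition,
    Low-Eval steps because the forcing function is positive at the positive
    stepsizes. *)
Lemma full_low_nonincreasing (R : realType) (n : nat) (f : 'rV[R]_n -> R)
    (P : full_low_constants R) (x0 : 'rV[R]_n) (h : history R n) (kappa : R) :
  generated_by_full_low f P x0 h -> 0 < kappa ->
  (forall k, itype h k = FullEval ->
     kappa < dot (- gk h k) (pk h k) / (enorm (gk h k) * enorm (pk h k))) ->
  forall k, f (iterate h k.+1) <= f (iterate h k).
Proof.
move=> hrun k0 angle k; have a0 := alpha_gt0 k hrun.
case: (hrun) => _ _ _ /(_ k); case tk: (itype h k) => -[_].
  case: (success h k) => [[accepts -> _]|[_ -> _] //].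
  have [g0 p0 {}angle] := angle_condition_nonzero k0 (angle k tk).
  case: accepts => j [_ bE _] /le_trans; apply.
  have /andP[b0 _] := trial_bounds P j; have /andP[c0 _] := armijo_c_bounds P.
  rewrite dotNl in angle.
  have descent_dir : dot (gk h k) (pk h k) <= 0.
    have : 0 < kappa * (enorm (gk h k) * enorm (pk h k)) by rewrite !mulr_gt0.
    by lra.
  by rewrite gerDl mulr_ge0_le0 // bE ltW // mulr_gt0.
case: (success h k) => [[[d _ [dec ->]] _]|[_ -> _] //].
apply: (le_trans dec); rewrite gerBl ltW //.
by have [rho0 _] := rho_forcing P; exact: rho0.
Qed.

(** * Convergence of the gradient *)

Theorem mainTheorem4 (R : realType) (n : nat) (f : 'rV[R]_n -> R)
    (P : full_low_constants R) (x0 : 'rV[R]_n) (h : history R n)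
    (L u_g kappa u_p : R)
    (hrun : generated_by_full_low f P x0 h)
    (hC1 : continuously_differentiable f)
    (hL : 0 < L) (hLip : lipschitz_gradient f L)
    (hug : 0 < u_g)
    (hgrad : forall k, successful_full_eval h k ->
       enorm (gradient f (iterate h k) - gk h k) <= u_g * beta h k * enorm (gk h k))
    (hkappa : 0 < kappa) (hup : 0 < u_p)
    (hdir : forall k, itype h k = FullEval ->
       kappa < dot (- gk h k) (pk h k) / (enorm (gk h k) * enorm (pk h k)) /\
       enorm (gk h k) <= u_p * enorm (pk h k))
    (hbound : has_lbound (range f))
    (hinf : infinite_set (successful_full_eval h)) :
  gradient f (iterate h k) @[k --> within (successful_full_eval h) \oo] --> (0 : 'rV[R]_n).
Proof.
have [df _] := hC1.
set u := fun k => f (iterate h k).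
set K := squared_gradient_factor P L u_g kappa u_p.
have u_noninc : nonincreasing_seq u.
  apply/nonincreasing_seqP => k.
  by apply: (full_low_nonincreasing hrun hkappa) => i /hdir[].
have u_lb : has_lbound (range u).
  have [m mf] := hbound.
  by exists m => _ [k _ <-]; apply: mf; exists (iterate h k).
have u_cvg := nonincreasing_cvgn u_noninc u_lb.
have decrease_cvg0 : (u k - u k.+1) @[k --> \oo] --> (0 : R).
  rewrite -(subrr (inf (range u))); apply: cvgB => //.
  by rewrite (cvg_shiftS u).
have bound_cvg0 : Num.sqrt (K * (u k - u k.+1)) @[k --> \oo] --> (0 : R).
  rewrite -(sqrtr0 R) -(mulr0 K).
  apply: (continuous_cvg _ (@sqrt_continuous R _)).
  exact: cvgMl_tmp.
apply/norm_cvg0P.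
apply: (@squeeze_cvgr _ _ _ _ (fun=> 0)
    (fun k => Num.sqrt (K * (u k - u k.+1)))).
- near=> k.
  have hk : successful_full_eval h k by near: k; exact: withinT.
  have [angle gp] := hdir k hk.1.
  have := successful_full_eval_decrease hrun df hL hLip hug hkappa hup
    (hgrad k hk) angle gp hk.
  rewrite normr_ge0 /= => /ler_wsqrtr; apply: le_trans.
  rewrite sqrtr_sqr ger0_norm ?enorm_ge0 //; exact: mx_norm_le_enorm.
- exact: cvg_cst.
- exact: cvg_within_filter.
Unshelve. all: by end_near.
Qed.
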